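(* Let $\mathbb F_{25}=\mathbb F_5[\alpha]$ with $\alpha^2=2$, and let $\gamma=1+2\alpha$, which is a primitive element of $\mathbb F_{25}$. Let $\rho:\mathbb F_{25}^*\to\{1,i,-1,-i\}$ be the multiplicative character (group homomorphism) determined by $\rho(\gamma)=i$, and let $\sigma:\mathbb F_5^*\to\{1,i,-1,-i\}$ be the multiplicative character determined by $\sigma(2)=-i$. Let $G=(\mathbb F_{25},+)\times(\mathbb F_5,+)\cong C_5^3$, and define \[ P=\{(x,y)\in\mathbb F_{25}^*\times\mathbb F_5^*:\rho(x)=\sigma(y)\},\qquad N=\{0\}\times\mathbb F_5^*,\qquad D=P-N\in\mathbb Z[G]. \] Then $D$ is a $(125,28,3)$-SDS in $G\cong C_5^3$.
   Context: $C_5$ denotes the cyclic group of order $5$, and $i=\sqrt{-1}\in\mathbb C$. Let $G$ be a finite group of order $v$, with identity denoted $0_G$. In the integral group ring $\mathbb Z[G]$, identify a subset $U\subseteq G$ with $\sum_{u\in U}u$, and for $D=\sum_{g\in G}a_g g$ write $D^{(-1)}=\sum_{g\in G}a_g g^{-1}$ (where $g^{-1}$ is the inverse of $g$ in $G$, i.e. $-g$ in additive notation). A signed subset of $G$ is an element $D=\sum_{g\in G}a_g g\in\mathbb Z[G]$ with all $a_g\in\{0,1,-1\}$; its support size is $k=|\{g\in G: a_g\neq 0\}|$. A signed subset $D$ of support size $k$ is a $(v,k,\lambda)$-signed difference set (SDS), with $\lambda\in\mathbb Z$, if $DD^{(-1)}=(k-\lambda)0_G+\lambda G$ in $\mathbb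 Z[G]$ (so the coefficient of the identity is $k$ and every other coefficient is $\lambda$). *)

(* Defs.v *)
From HB Require Import structures.
From mathcomp Require Import all_boot all_order all_algebra all_fingroup.
From mathcomp Require Import all_solvable all_field.

Set Implicit Arguments.
Unset Strict Implicit.
Unset Printing Implicit Defensive.

Import Order.TTheory GRing.Theory Num.Theory.
Local Open Scope ring_scope.

(* The additive group of Z[G]; the (convolution) product is [gr_mul].
   The ring_scope operations on {ffun gT -> int} other than the additive ones
   are pointwise and are not used. *)
Definition group_ring (gT : finGroupType) := {ffun gT -> int}.

Section GroupRing.

Variable gT : finGroupType.
Implicit Types D E : group_ring gT.

Definition gr_mul D E : group_ring gT :=
  [ffun g => \sum_(u : gT * gT | (u.1 * u.2)%g == g) D u.1 * E u.2].

Definition gr_set (U : {set gT}) : group_ring gT :=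
  [ffun g => (g \in U)%:R].

Definition gr_inv D : group_ring gT := [ffun g => D g^-1%g].

Definition signed_subset D := forall g, D g \in [:: 0; 1; -1].

Definition support_size D : nat := #|[set g | D g != 0]|.

Definition is_SDS (v k : nat) (lambda : int) D : Prop :=
  [/\ #|gT| = v, signed_subset D, support_size D = k &
      gr_mul D (gr_inv D) =
        gr_set [set 1%g] *~ (k%:Z - lambda) + gr_set [set: gT] *~ lambda].

End GroupRing.

Section Characters.

Variable F : finFieldType.

Definition primitive_element (x : F) : Prop :=
  x != 0 /\ forall y : F, y != 0 -> exists n : nat, y = x ^+ n.

(* A homomorphism from F^* to {1, i, -1, -i}, given as a function on F whose
   value at 0 is arbitrary and never used. *)
Definition quartic_character (chi : F -> algC) : Prop :=
  (forall x y : F, x != 0 -> y != 0 -> chi (x * y) = chi x * chi y) /\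
  (forall x : F, x != 0 -> chi x \in [:: 1; 'i; -1; - 'i]).

End Characters.

Section Construction.

Variables (F : finFieldType) (rho : F -> algC) (sigma : 'F_5 -> algC).

(* As a finGroupType, a product of finite fields is the direct product of their
   additive groups. *)
Definition SDS_P : {set F * 'F_5} :=
  [set z | [&& z.1 != 0, z.2 != 0 & rho z.1 == sigma z.2]].

Definition SDS_N : {set F * 'F_5} := [set z | (z.1 == 0) && (z.2 != 0)].

Definition SDS_D : group_ring (F * 'F_5)%type := gr_set SDS_P - gr_set SDS_N.

End Construction.

(* Main.v *)
Require Import Defs.
From HB Require Import structures.
From mathcomp Require Import all_boot all_order all_algebra all_fingroup.
From mathcomp Require Import all_solvable all_field ring.

Set Implicit Arguments.
Unset Strict Implicit.
Unset Printing Implicit Defensive.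

Import Order.TTheory GRing.Theory Num.Theory.
Local Open Scope ring_scope.

(** The set [P] is the graph of the norm [N : F_25 -> F_5], [N x = x ^+ 6], away
    from [0].  Indeed [N gamma = 3] and [sigma 3 = 'i = rho gamma], so that
    [rho x = sigma (N x)] for every nonzero [x], while [sigma] is injective on
    the nonzero elements ([characters_agree_iff_norm]).  Write [Q] for the whole
    graph of [N] and [L = {0} x F_5].  Since [N 0 = 0], the points of [Q] and
    [L] at the origin cancel and [D = Q - L] ([SDS_D_norm_graph]).

    The group ring identity only uses that [N] is planar: for [s != 0] the
    difference [x |-> N (x + s) - N x] takes every value equally often.  Let
    [f : A -> B] be planar with [#|B| = q] and [#|A| = q ^ 2], and let [Q] be
    its graph and [L] the fibre [{0} x B].  Then
    - [Q Q^(-1) = q^2 0 + q (G - L)], as each of the [q] values of a nontrivial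
      difference of [f] is taken [q] times;
    - [Q L^(-1) = L Q^(-1) = G], as a graph is a transversal of [L];
    - [L L^(-1) = q L].
    The multiples of [L] cancel in [(Q - L) (Q - L)^(-1)], which is
    [q^2 0 + (q - 2) G] ([planar_graph_SDS]); for [q = 5] this is
    [25 0 + 3 G].

    The norm from a field of [q ^ 2] elements to its subfield of [q] elements is
    planar ([planar_rel_norm]): as [x |-> x ^+ q] is additive,
    [N (x + s) - N x = s * x ^+ q + s ^+ q * x + s ^+ q.+1].  For [s != 0] this
    polynomial of degree [q] takes each value at most [q] times, and the [q]
    possible values share [q ^ 2] arguments, so each is taken exactly [q]
    times.

    That [gamma] is primitive and that the characters exist follows from the
    multiplicative orders of [gamma] and of [3] in [F_5], which are [24] and [4]:
    the characters are powers of [ 'i ] with discrete logarithms as exponents.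
    The group is [C_5^3] because it is abelian of order [125] and exponent [5]. *)

(** * Autocorrelation of signed subsets *)

Lemma coef_autocorrelation (gT : finGroupType) (D : group_ring gT) (g : gT) :
  gr_mul D (gr_inv D) g = \sum_h D (g * h)%g * D h.
Proof.
rewrite ffunE (reindex (fun h : gT => ((g * h)%g, h^-1%g))) /=; last first.
  exists (fun u => u.2^-1%g) => [h _|[u v]] /=; first by rewrite invgK.
  by rewrite inE /= => /eqP<-; rewrite invgK mulgK.
by apply: eq_big => [h|h _]; rewrite ?mulgK ?eqxx // ffunE invgK.
Qed.

(** An entry [0], [1] or [-1] has square [1] exactly on the support, so the
    support size is the coefficient of the identity in [D D^(-1)]. *)
Lemma support_size_autocorrelation (gT : finGroupType) (D : group_ring gT) :
  signed_subset D -> (support_size D)%:Z = gr_mul D (gr_inv D) 1%g.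
Proof.
move=> sgnD; rewrite coef_autocorrelation /support_size cardsE -sum1_card.
rewrite -natz natr_sum big_mkcond /=; apply: eq_bigr => h _.
rewrite mul1g unfold_in /=; have := sgnD h.
by rewrite !inE => /or3P[]/eqP->.
Qed.

Lemma sum_indicator (R : pzSemiRingType) (T : finType) (a : T) :
  \sum_x ((x == a)%:R : R) = 1.
Proof. by rewrite -natr_sum -big_mkcond big_pred1_eq. Qed.

(** * Graphs of planar functions *)

Section PlanarFunctions.

Variables (A B : finZmodType) (f : A -> B).

(** The product with [#|B|] states that fibres have size [#|A| / #|B|] without
    a division. *)
Definition planar := forall (s : A) (t : B),
  s != 0 -> (#|[set x | (f (x + s) - f x)%R == t]| * #|B|)%N = #|A|.

(** The two sets meet in [(0, f 0)], where the coefficient is [0]. *)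
Definition graph_minus_fiber : group_ring (A * B)%type :=
  gr_set [set z : A * B | z.2 == f z.1] - gr_set [set z : A * B | z.1 == 0].

Lemma graph_minus_fiberE (x : A) (y : B) :
  graph_minus_fiber (x, y) = (y == f x)%:R - (x == 0)%:R.
Proof. by rewrite !ffunE !inE. Qed.

Lemma signed_subset_graph_minus_fiber : signed_subset graph_minus_fiber.
Proof. by move=> [x y]; rewrite graph_minus_fiberE; do 2!case: (_ == _). Qed.

(** Shifting by [(s, t)] makes the graph meet itself in the solutions of
    [f (x + s) - f x = t]; the graph and the fibre meet in one point in each of
    the two mixed terms, whence [- 2]; and the fibre meets its shift only if
    [s = 0], in [#|B|] points. *)
Lemma autocorrelation_graph_minus_fiber (s : A) (t : B) :
  gr_mul graph_minus_fiber (gr_inv graph_minus_fiber) (s, t) =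
    #|[set x | f (x + s) - f x == t]|%:Z - 2 + (s == 0)%:R * #|B|%:Z.
Proof.
(* For fixed [x], the sum over [y] has two factors of the form indicator of a
   single [y] minus a constant, so it expands into four terms. *)
pose a (x : A) : int := (x == - s)%:R; pose b (x : A) : int := (x == 0)%:R.
pose p (x : A) (y : B) : int := (y == f (x + s) - t)%:R.
pose q (x : A) (y : B) : int := (y == f x)%:R.
have common x : \sum_y p x y * q x y = (f (x + s) - f x == t)%:R.
  rewrite (bigD1 (f x)) //= /p /q eqxx mulr1 big1 ?addr0 => [|y /negPf->].
    by rewrite eq_sym subr_eq [f x + t]addrC -subr_eq.
  by rewrite mulr0.
rewrite coef_autocorrelation.
transitivity (\sum_x \sum_y (p x y - a x) * (q x y - b x)).
  rewrite pair_bigA; apply: eq_bigr => -[x y] _ /=.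
  have ->: ((s, t) * (x, y))%g = (s + x, t + y) :> A * B by [].
  rewrite !graph_minus_fiberE /p /a.
  rewrite [t + y]addrC [s + x]addrC addr_eq0.
  by rewrite [y == _ - t]eq_sym subr_eq eq_sym.
transitivity (\sum_x ((f (x + s) - f x == t)%:R - a x - b x
                       + b x * ((s == 0)%:R * #|B|%:Z))).
  apply: eq_bigr => x _; rewrite -common.
  under eq_bigr do rewrite mulrBl !mulrBr.
  rewrite !sumrB -mulr_suml -mulr_sumr !sum_indicator mulr1 mul1r sumr_const.
  have -> : a x * b x = b x * (s == 0)%:R.
    rewrite /b; case: eqP => [->|_]; last by rewrite mulr0 mul0r.
    by rewrite mulr1 mul1r /a eq_sym oppr_eq0.
  by rewrite mulrA -[#|_|%:Z]natz mulr_natr; ring.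
rewrite big_split /= !sumrB -mulr_suml !sum_indicator mul1r.
by congr (_ + _); rewrite -addrA -opprD -natr_sum -big_mkcond sum1dep_card natz.
Qed.

(** The autocorrelation is [q - 2] off the origin for two different reasons:
    for [s != 0] the planar function contributes [q] and the fibre nothing,
    while for [s = 0] the fibre contributes [q] and the graph nothing. *)
Lemma planar_graph_SDS :
  planar -> #|A| = (#|B| ^ 2)%N ->
  is_SDS (#|B| ^ 3) (#|B| ^ 2 + #|B| - 2) (#|B|%:Z - 2) graph_minus_fiber.
Proof.
move=> planarf cardA; set q := #|B|.
have q_gt0 : (0 < q)%N by apply/card_gt0P; exists 0.
have sgnD := signed_subset_graph_minus_fiber.
have coef1 : gr_mul graph_minus_fiber (gr_inv graph_minus_fiber) 1%g
    = (q ^ 2)%:Z - 2 + q%:Z.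
  have -> : 1%g = (0, 0) :> A * B by [].
  rewrite autocorrelation_graph_minus_fiber eqxx mul1r -cardA.
  congr (_%:Z - _ + _); rewrite -cardsT; apply: eq_card => x.
  by rewrite !inE addr0 subrr eqxx.
have size1 := support_size_autocorrelation sgnD.
rewrite coef1 in size1.
have sizeE : (support_size graph_minus_fiber = q ^ 2 + q - 2)%N.
  apply/eqP; rewrite -eqz_nat size1 -subzn ?PoszD 1?addrAC //.
  by rewrite (@leq_add 1 1) ?expn_gt0 ?q_gt0.
split=> //; first by rewrite card_prod cardA -expnSr.
apply/ffunP=> -[s t]; rewrite [RHS]ffunE !ffunMzE ![gr_set _ _]ffunE in_setT.
have -> : ((s, t) \in [set 1%g : A * B]) = (s == 0) && (t == 0) by rewrite inE.
rewrite -sizeE size1; have [s0|s_neq0] := eqVneq s 0; last first.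
  rewrite autocorrelation_graph_minus_fiber (negPf s_neq0) mul0r mul0rz.
  rewrite add0r addr0 intz.
  have /eqP := planarf s t s_neq0.
  by rewrite cardA -mulnn eqn_pmul2r // => /eqP->.
have [t0|t_neq0] := eqVneq t 0.
  by rewrite s0 t0 coef1 /= !intz subrK.
rewrite autocorrelation_graph_minus_fiber s0 eqxx mul1r !mul0rz.
rewrite (_ : [set x | _] = set0) ?cards0 ?intz.
  by rewrite sub0r !add0r addrC.
by apply/setP=> x; rewrite !inE addr0 subrr eq_sym (negPf t_neq0).
Qed.

End PlanarFunctions.

(** * The norm of a quadratic extension of finite fields *)

Lemma card_fiber_eq_bound (A B : finType) (g : A -> B) (m : nat) :
  (forall t, #|[set x | g x == t]| <= m)%N -> #|A| = (m * #|B|)%N ->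
  forall t, #|[set x | g x == t]| = m.
Proof.
move=> le_m cardA.
have [_] := leqif_sum (fun t (_ : true) => leqif_eq (le_m t)).
rewrite sum_nat_const mulnC -cardA -sum1_card (partition_big g xpredT) //=.
under eq_bigr do rewrite -sum1dep_card.
by rewrite eqxx => /esym/forallP fib t; apply/eqP/fib.
Qed.

Section RelativeNorm.

Variables (K F : finFieldType) (iota : {rmorphism K -> F}).
Local Notation q := #|K|.

Lemma subfield_frobenius_additive (x y : F) : (x + y) ^+ q = x ^+ q + y ^+ q.
Proof.
have [p p_pr pcharK] := finPcharP K.
have pcharF : p \in [pchar F] by rewrite (fmorph_pchar iota).
apply: exprDn_pchar; rewrite (eq_pnat _ (pcharf_eq pcharF)).
have := abelem_pgroup (fin_ring_pchar_abelem pcharK).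
by rewrite /pgroup cardsT.
Qed.

(** Mapping ['X^q - 'X = \prod_(y : K) ('X - y%:P)] to [F] and evaluating at [x]
    gives a vanishing product, hence a vanishing factor [x - iota y]. *)
Lemma frobenius_fixed_in_subfield (x : F) : x ^+ q = x -> {y | iota y = x}.
Proof.
move=> fix_x; apply/sig_eqW.
have := congr1 (fun r => (map_poly iota r).[x]) (finField_genPoly K).
rewrite rmorphB /= map_polyXn map_polyX !hornerE fix_x subrr.
rewrite rmorph_prod horner_prod => /esym/eqP/prodf_eq0[y _].
rewrite rmorphB /= map_polyX map_polyC !hornerE subr_eq0 => /eqP->.
by exists y.
Qed.

Hypothesis cardF : #|F| = (q ^ 2)%N.

Lemma norm_in_subfield (x : F) : {y | iota y = x ^+ q.+1}.
Proof.
apply: frobenius_fixed_in_subfield.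
by rewrite -exprM mulSn mulnn exprD -cardF expf_card -exprSr.
Qed.

(** The norm of [F] over [K]: the conjugates of [x] are [x] and [x ^+ q]. *)
Definition rel_norm (x : F) : K := sval (norm_in_subfield x).

Lemma rel_normE (x : F) : iota (rel_norm x) = x ^+ q.+1.
Proof. exact: svalP (norm_in_subfield x). Qed.

Lemma rel_norm0 : rel_norm 0 = 0.
Proof. by apply: (@fmorph_inj _ _ iota); rewrite rel_normE rmorph0 expr0n. Qed.

Lemma rel_normX (x : F) (n : nat) : rel_norm (x ^+ n) = rel_norm x ^+ n.
Proof. by apply: (@fmorph_inj _ _ iota); rewrite rmorphXn !rel_normE exprAC. Qed.

(** Each difference is a polynomial of degree [q] in [x], which bounds the
    fibres by [q]; a map from [q ^ 2] to [q] elements then attains the bound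
    everywhere. *)
Lemma planar_rel_norm : planar rel_norm.
Proof.
move=> s t s_neq0; rewrite cardF -mulnn; congr (_ * _)%N.
apply: (card_fiber_eq_bound (g := fun x => rel_norm (x + s) - rel_norm x));
  last by rewrite cardF mulnn.
move=> {}t; pose r := s *: 'X^q + (s ^+ q *: 'X + (s ^+ q.+1 - iota t)%:P).
have size_r : size r = q.+1.
  rewrite size_polyDl size_scale // size_polyXn // ltnS.
  rewrite (leq_trans (size_polyD _ _)) // geq_max.
  rewrite (leq_trans (size_scale_leq _ _)) ?size_polyX ?finNzRing_gt1 //.
  by rewrite (leq_trans (size_polyC_leq1 _)) // ltnW ?finNzRing_gt1.
rewrite cardE -ltnS -size_r max_poly_roots ?enum_uniq -?size_poly_gt0 ?size_r //.
apply/allP=> x; rewrite mem_enum inE /r => /eqP <-.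
rewrite rootE !hornerD !hornerZ hornerXn hornerX hornerC.
rewrite rmorphB !rel_normE !exprS subfield_frobenius_additive.
by apply/eqP; ring.
Qed.

End RelativeNorm.

(** * Primitive roots and quartic characters *)

(** If the order [m] of [z] were a proper divisor of [n], then [m] would divide
    [n %/ p] for a prime divisor [p] of [n %/ m]. *)
Lemma primitive_root_maximal_exponents (R : nzRingType) (z : R) (n : nat) :
  (0 < n)%N -> z ^+ n = 1 ->
  (forall p, prime p -> (p %| n)%N -> z ^+ (n %/ p) != 1) ->
  n.-primitive_root z.
Proof.
move=> n_gt0 zn1 maxz; have [m zm /dvdnP[k nE]] := prim_order_exists n_gt0 zn1.
have [k1|k_neq1] := eqVneq k 1%N; first by rewrite nE k1 mul1n.
have k_gt1 : (1 < k)%N.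
  by case: k nE k_neq1 n_gt0 => [|[|k]] // ->.
have /dvdnP[l kE] := pdiv_dvd k; have p_pr := pdiv_prime k_gt1.
have dvd_n : (pdiv k %| n)%N by rewrite nE dvdn_mulr ?pdiv_dvd.
case/negP: (maxz _ p_pr dvd_n); rewrite -(prim_order_dvd zm) nE {1}kE.
by rewrite mulnAC mulnK ?prime_gt0 // dvdn_mull.
Qed.

Lemma primitive_root_primitive_element (F : finFieldType) (g : F) :
  (#|F|.-1).-primitive_root g -> primitive_element g.
Proof.
move=> prim_g; split.
  apply/eqP=> g0; move/eqP: (prim_expr_order prim_g).
  by rewrite g0 expr0n (gtn_eqF (prim_order_gt0 prim_g)) eq_sym oner_eq0.
move=> y y_neq0; have /(prim_rootP prim_g)[n ->] : y ^+ #|F|.-1 = 1.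
  apply: (mulfI y_neq0).
  by rewrite mulr1 -exprS (ltn_predK (finNzRing_gt1 F)) expf_card.
by exists n.
Qed.

Lemma fourth_roots_of_unity (z : algC) :
  (z \in [:: 1; 'i; -1; - 'i]) = (z ^+ 4 == 1).
Proof.
have -> : (z ^+ 4 == 1) = ((z - 1) * (z - 'i) * ((z + 1) * (z + 'i)) == 0).
  rewrite -subr_eq0; congr (_ == _).
  have i2 := sqrCi algC.
  transitivity ((z ^+ 2 - 1) * (z ^+ 2 - 'i ^+ 2)); last by ring.
  by rewrite i2; ring.
by rewrite !mulf_eq0 !subr_eq0 !addr_eq0 !inE -!orbA.
Qed.

Lemma imaginary_unit_primitive_root : 4.-primitive_root ('i : algC).
Proof.
apply: primitive_root_maximal_exponents => // [|p p_pr p_dvd4].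
  by apply/eqP; rewrite -fourth_roots_of_unity !inE eqxx orbT.
have : p \in primes 4 by rewrite mem_primes p_pr.
by rewrite inE => /eqP->; rewrite sqrCi eq_sym -addr_eq0 -mulr2n pnatr_eq0.
Qed.

Lemma quartic_characterX (F : finFieldType) (chi : F -> algC) (x : F) (n : nat) :
  quartic_character chi -> x != 0 -> chi (x ^+ n) = chi x ^+ n.
Proof.
move=> [chiM chi_root] x_neq0.
have chi1 : chi 1 = 1.
  have chi1_neq0 : chi 1 != 0.
    have := chi_root 1 (oner_neq0 _).
    rewrite fourth_roots_of_unity; apply: contraTneq => ->.
    by rewrite expr0n eq_sym oner_eq0.
  by apply: (mulfI chi1_neq0); rewrite -chiM ?oner_neq0 // !mulr1.
elim: n => [|n IHn]; first by rewrite !expr0.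
by rewrite !exprS chiM ?expf_neq0 // IHn.
Qed.

(** The character is [x |-> 'i ^+ log x], where [log] is the discrete logarithm
    to base [g].  It is multiplicative because logarithms add modulo [#|F|.-1],
    a multiple of the order [4] of [ 'i ]. *)
Lemma quartic_character_exists (F : finFieldType) (g : F) :
  (#|F|.-1).-primitive_root g -> (4 %| #|F|.-1)%N ->
  exists chi : F -> algC, quartic_character chi /\ chi g = 'i.
Proof.
move=> prim_g dvd4.
pose log x : nat := oapp val 0%N [pick n : 'I_(#|F|.-1) | x == g ^+ n].
have logE n : 'i ^+ log (g ^+ n) = 'i ^+ n :> algC.
  apply/eqP; rewrite (eq_prim_root_expr imaginary_unit_primitive_root) /log.
  case: pickP => [m | /(_ (Ordinal (ltn_pmod n (prim_order_gt0 prim_g))))] /=.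
    rewrite (eq_prim_root_expr prim_g) => /eqP eq_mod.
    by rewrite -(modn_dvdm _ dvd4) -eq_mod modn_dvdm.
  by rewrite (eq_prim_root_expr prim_g) modn_mod eqxx.
have [_ g_gen] := primitive_root_primitive_element prim_g.
exists (fun x => 'i ^+ log x); split; last by rewrite -[g]expr1 logE.
split=> [x y|x] /g_gen[m ->].
  by case/g_gen=> n ->; rewrite -exprD !logE exprD.
rewrite logE fourth_roots_of_unity exprAC.
by rewrite (prim_expr_order imaginary_unit_primitive_root) expr1n eqxx.
Qed.

(** * Products of elementary abelian groups *)

Lemma abelem_prod (gT rT : finGroupType) (p : nat) : prime p ->
  (p.-abelem [set: gT] -> p.-abelem [set: rT] -> p.-abelem [set: gT * rT])%g.
Proof.
move=> p_pr; rewrite !abelemE // => /andP[/centsP abG /exponentP expG].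
case/andP=> [/centsP abH /exponentP expH]; apply/andP; split.
  apply/centsP=> -[x y] _ [x' y'] _; congr pair.
    by apply: abG; rewrite inE.
  by apply: abH; rewrite inE.
apply/exponentP=> -[x y] _.
have -> n : ((x, y) ^+ n = (x ^+ n, y ^+ n))%g.
  by elim: n => // n IHn; rewrite !expgS IHn.
by rewrite expG ?expH ?inE.
Qed.

(** * The field with 25 elements *)

Section FieldOf25.

Variables (F : finFieldType) (alpha : F).
Hypotheses (cardF : #|F| = 25%N) (alpha2 : alpha ^+ 2 = 2).
Local Notation gamma := (1 + 2 * alpha).

Lemma pchar_field25 : 5 \in [pchar F].
Proof. exact: (@card_finPcharP F 5 2). Qed.

Lemma gamma_powers : gamma ^+ 6 = 3 /\ gamma ^+ 8 = 1 + gamma.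
Proof.
have five0 : 5 = 0 :> F := pcharf0 pchar_field25.
(* An identity in [F] is certified by its cofactors [u], [v] in the ideal
   generated by [5] and [alpha ^+ 2 - 2]. *)
have reduce (x y u v : F) : x = y + 5 * u + (alpha ^+ 2 - 2) * v -> x = y.
  by rewrite five0 alpha2 subrr !mul0r !addr0.
have gamma2 : gamma ^+ 2 = - 1 - alpha.
  by apply: (reduce _ _ (2 + alpha) 4); ring.
have gamma4 : gamma ^+ 4 = 3 + 2 * alpha.
  by rewrite (exprM _ 2 2) gamma2; apply: (reduce _ _ 0 1); ring.
split; first rewrite (exprD _ 4 2) gamma2 gamma4.
  by apply: (reduce _ _ (- 2 - alpha) (- 2)); ring.
rewrite (exprM _ 4 2) gamma4.
by apply: (reduce _ _ (3 + 2 * alpha) 4); ring.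
Qed.

(** The exponents to exclude are [24 / 2] and [24 / 3]:
    [gamma ^+ 12 = 3 ^+ 2 = - 1], and [gamma ^+ 8 - 1 = gamma] is nonzero. *)
Lemma gamma_primitive_root : 24.-primitive_root gamma.
Proof.
have [gamma6 gamma8] := gamma_powers.
have natF_neq0 n : ~~ (5 %| n)%N -> n%:R != 0 :> F.
  by rewrite (dvdn_pcharf pchar_field25).
have gamma12 : gamma ^+ 12 = - 1.
  rewrite (exprM _ 6 2) gamma6; apply/eqP; rewrite -subr_eq0.
  have -> : 3 ^+ 2 - - 1 = 5 * 2 :> F by ring.
  by rewrite (pcharf0 pchar_field25) mul0r.
apply: primitive_root_maximal_exponents => // [|p p_pr p_dvd24].
  by rewrite (exprM _ 12 2) gamma12 sqrrN expr1n.
have : p \in primes 24 by rewrite mem_primes p_pr.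
rewrite !inE => /orP[]/eqP->.
  by rewrite gamma12 eq_sym -addr_eq0 -mulr2n natF_neq0.
rewrite gamma8 -subr_eq0 addrAC subrr add0r.
apply: contraTneq (natF_neq0 3 isT) => gamma0.
by rewrite -gamma6 gamma0 expr0n eqxx.
Qed.

Lemma three_primitive_root : 4.-primitive_root (3 : 'F_5).
Proof.
apply: primitive_root_maximal_exponents => // [|p p_pr p_dvd4].
  by apply/eqP.
have : p \in primes 4 by rewrite mem_primes p_pr.
by rewrite inE => /eqP->.
Qed.

Lemma isog_Z5_cubed :
  [set: F * 'F_5] \isog [set: 'Z_5 * 'Z_5 * 'Z_5].
Proof.
have prime5 : prime 5 by [].
have abF5 := fin_ring_pchar_abelem (pchar_Fp prime5).
have abG := abelem_prod prime5 (fin_ring_pchar_abelem pchar_field25) abF5.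
have abZ := abelem_prod prime5 (abelem_prod prime5 abF5 abF5) abF5.
rewrite (isog_abelem_card _ abG) abZ /=.
by rewrite !cardsT !card_prod cardF !card_ord.
Qed.

Variables (rho : F -> algC) (sigma : 'F_5 -> algC).
Hypotheses (rho_char : quartic_character rho) (rho_gamma : rho gamma = 'i).
Hypotheses (sigma_char : quartic_character sigma) (sigma_2 : sigma 2 = - 'i).
Variable iota : {rmorphism 'F_5 -> F}.
Hypothesis cardF_sq : #|F| = (#|'F_5| ^ 2)%N.
Local Notation N := (rel_norm iota cardF_sq).

Lemma rel_norm_gamma : N gamma = 3.
Proof.
apply: (@fmorph_inj _ _ iota); rewrite rel_normE card_Fp // rmorph_nat.
by case: gamma_powers.
Qed.

(** Both characters send the chosen generators, [gamma] and [3], to [ 'i ], and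
    [N] sends [gamma] to [3].  For [x = gamma ^+ m] and [y = 3 ^+ n], each side
    says that [m] and [n] agree modulo [4]. *)
Lemma characters_agree_iff_norm (x : F) (y : 'F_5) : x != 0 -> y != 0 ->
  (rho x == sigma y) = (y == N x).
Proof.
have prim_gamma : (#|F|.-1).-primitive_root gamma.
  by rewrite cardF gamma_primitive_root.
have prim_3 : (#|'F_5|.-1).-primitive_root (3 : 'F_5).
  by rewrite card_Fp // three_primitive_root.
have sigma_3 : sigma 3 = 'i.
  have -> : 3 = 2 ^+ 3 :> 'F_5 by apply/eqP.
  by rewrite quartic_characterX // sigma_2 exprS sqrrN sqrCi mulrN1 opprK.
have [gamma_neq0 gamma_gen] := primitive_root_primitive_element prim_gamma.
have [three_neq0 three_gen] := primitive_root_primitive_element prim_3.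
move=> /gamma_gen[m ->] /three_gen[n ->].
rewrite !quartic_characterX // rho_gamma sigma_3 rel_normX rel_norm_gamma.
rewrite (eq_prim_root_expr imaginary_unit_primitive_root) eq_sym.
by rewrite (eq_prim_root_expr three_primitive_root).
Qed.

(** On the fibre over [0], the point [(0, N 0) = (0, 0)] of the graph cancels the
    origin of the fibre, so that only the other points of the fibre count;
    elsewhere [N x] is nonzero, as [SDS_P] demands of second coordinates. *)
Lemma SDS_D_norm_graph : SDS_D rho sigma = graph_minus_fiber N.
Proof.
apply/ffunP=> -[x y]; rewrite graph_minus_fiberE !ffunE !inE /=.
have [->|x_neq0] := eqVneq x 0.
  by rewrite rel_norm0; case: (y == 0).
have [->|y_neq0] := eqVneq y 0; last by rewrite characters_agree_iff_norm.
have : N x != 0 by rewrite -(fmorph_eq0 iota) rel_normE expf_neq0.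
by rewrite eq_sym => /negPf->.
Qed.

End FieldOf25.

Theorem theorem5p6 (F : finFieldType) (alpha : F) (cardF : #|F| = 25%N)
    (alpha2 : alpha ^+ 2 = 2) :
  let gamma := 1 + 2 * alpha in
  [/\ primitive_element gamma,
      exists rho : F -> algC, quartic_character rho /\ rho gamma = 'i,
      exists sigma : 'F_5 -> algC, quartic_character sigma /\ sigma 2 = - 'i,
      [set: F * 'F_5] \isog [set: 'Z_5 * 'Z_5 * 'Z_5] &
      forall (rho : F -> algC) (sigma : 'F_5 -> algC),
        quartic_character rho -> rho gamma = 'i ->
        quartic_character sigma -> sigma 2 = - 'i ->
        is_SDS 125 28 3 (SDS_D rho sigma)].
Proof.
move=> gamma; have prim_gamma : (#|F|.-1).-primitive_root gamma.
  by rewrite cardF gamma_primitive_root.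
split.
- exact: primitive_root_primitive_element.
- by apply: (quartic_character_exists prim_gamma); rewrite cardF.
- have [||sigma [sigma_char sigma_3]] := @quartic_character_exists 'F_5 3.
  + by rewrite card_Fp // three_primitive_root.
  + by rewrite card_Fp.
  exists sigma; split=> //; have -> : 2 = 3 ^+ 3 :> 'F_5 by apply/eqP.
  by rewrite quartic_characterX // sigma_3 exprS sqrCi mulrN1.
- exact: isog_Z5_cubed.
move=> rho sigma rho_char rho_gamma sigma_char sigma_2.
have pcharF := pchar_field25 cardF.
(* The prime subfield, as the scalars of the ['F_5]-algebra structure of [F]. *)
pose iota : {rmorphism 'F_5 -> F} :=
  (in_alg (pPrimeCharType pcharF) : {rmorphism 'F_5 -> pPrimeCharType pcharF}).
have cardF_sq : #|F| = (#|'F_5| ^ 2)%N by rewrite card_Fp.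
rewrite (SDS_D_norm_graph cardF alpha2 rho_char rho_gamma sigma_char sigma_2
  iota cardF_sq).
have := planar_graph_SDS (@planar_rel_norm _ _ iota cardF_sq) cardF_sq.
by rewrite card_Fp.
Qed.
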